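(* Consider the Int-GARCH(1,1,1) model: for integers $t$, $$r_t=h_t\cdot[\epsilon_t-\eta_t,\ \epsilon_t+\eta_t]=[\lambda_t-\delta_t,\ \lambda_t+\delta_t],\qquad \lambda_t=h_t\epsilon_t,\ \delta_t=h_t\eta_t,$$ $$h_t=\mu+\alpha_1|\lambda_{t-1}|+\beta_1\delta_{t-1}+\gamma_1h_{t-1},$$ where $\mu>0$, $\alpha_1,\beta_1,\gamma_1>0$ are constants, $\{\epsilon_t\}$ are i.i.d. $N(0,1)$, $\{\eta_t\}$ are i.i.d. $\Gamma(k,1)$ (shape $k>0$, scale $1$), the two sequences are mutually independent, and $(\epsilon_t,\eta_t)$ is independent of $\{h_s: s\le t\}$. Put $x_t=\alpha_1|\epsilon_t|+\beta_1\eta_t+\gamma_1$, so that $h_t=\mu+x_{t-1}h_{t-1}$. Assume $\{r_t\}$ starts from its infinite past with a finite mean (the recursion is started in the infinite past from a value with finite expectation). Then $E h_t<\infty$ if and only if $E x_t<1$, i.e. $$\alpha_1\sqrt{2/\pi}+\beta_1k+\gamma_1<1.$$ When this condition holds, $$E h_t=\frac{\mu}{1-\alpha_1\sqrt{2/\pi}-\beta_1k-\gamma_1},\qquad E r_t=\bigl[-kE(h_t),\ kE(h_t)\bigr].$$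
   Context: Here $\cdot$ denotes scalar multiplication of an interval, $[a,b]\cdot c=\{cx: x\in[a,b]\}$ for $c\ge 0$. The expectation of a random interval $r_t=[\lambda_t-\delta_t,\lambda_t+\delta_t]$ is its Aumann expectation, which for intervals equals $E(r_t)=[E\lambda_t-E\delta_t,\ E\lambda_t+E\delta_t]$. *)

(* Defs.v *)
From HB Require Import structures.
From mathcomp Require Import all_boot all_order all_algebra.
From mathcomp Require Import all_classical all_reals all_analysis.
From mathcomp Require Export normal_distribution.
Set Implicit Arguments.
Unset Strict Implicit.
Unset Printing Implicit Defensive.
Import Order.TTheory GRing.Theory Num.Theory.
Import numFieldNormedType.Exports.
Local Open Scope classical_set_scope.
Local Open Scope ring_scope.

Notation mu_leb := lebesgue_measure.

Definition Gamma_fun {R : realType} (k : R) : R :=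
  fine (\int[@lebesgue_measure R]_(x in `]0%R, +oo[) (x `^ (k - 1) * expR (- x))%:E)%E.

Definition gamma_pdf {R : realType} (k : R) (x : R) : R :=
  if 0 < x then x `^ (k - 1) * expR (- x) / Gamma_fun k else 0.

Definition gamma_prob {R : realType} (k : R) : set R -> \bar R :=
  fun A => (\int[@lebesgue_measure R]_(x in A) (gamma_pdf k x)%:E)%E.

Section indep.
Context {d} {T : measurableType d} {R : realType} (P : probability T R).

Definition mutually_independent {I : eqType} (X : I -> T -> R) : Prop :=
  forall (J : seq I) (A : I -> set R), uniq J ->
    (forall i, measurable (A i)) ->
    P (\bigcap_(i in [set` J]) (X i @^-1` A i)) =
    (\big[*%E/1%E]_(i <- J) P (X i @^-1` A i))%E.

(* independence of the families {X i : i in SX} and {Y j : j in SY}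
   (i.e. of the sigma-algebras they generate) *)
Definition independent_families {I J : eqType} (X : I -> T -> R) (SX : set I)
    (Y : J -> T -> R) (SY : set J) : Prop :=
  forall (JX : seq I) (JY : seq J) (A : I -> set R) (B : J -> set R),
    [set` JX] `<=` SX -> [set` JY] `<=` SY ->
    (forall i, measurable (A i)) -> (forall j, measurable (B j)) ->
    P ((\bigcap_(i in [set` JX]) (X i @^-1` A i)) `&`
       (\bigcap_(j in [set` JY]) (Y j @^-1` B j))) =
    (P (\bigcap_(i in [set` JX]) (X i @^-1` A i)) *
     P (\bigcap_(j in [set` JY]) (Y j @^-1` B j)))%E.

(* Aumann expectation of the random interval [lam - del, lam + del],
   represented by its pair of endpoints *)
Definition interval_expectation (lam del : T -> R) : \bar R * \bar R :=
  ('E_P[lam] - 'E_P[del], 'E_P[lam] + 'E_P[del])%E.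

End indep.

Section garch.
Context {T : Type} {R : realType}.

Definition lam (h eps : int -> T -> R) (t : int) (w : T) : R := h t w * eps t w.
Definition del (h eta : int -> T -> R) (t : int) (w : T) : R := h t w * eta t w.

Definition xproc (alpha beta gamma : R) (eps eta : int -> T -> R)
  (t : int) (w : T) : R := alpha * `|eps t w| + beta * eta t w + gamma.

(* garch_from mu x V n t = value at time t of the recursion
   h_s = mu + x_{s-1} h_{s-1} started at time t - n from the value V *)
Fixpoint garch_from (mu : R) (x : int -> T -> R) (V : T -> R)
    (n : nat) (t : int) (w : T) : R :=
  match n with
  | 0 => V w
  | n'.+1 => mu + x (t - 1) w * garch_from mu x V n' (t - 1) w
  end.

End garch.

Definition started_in_infinite_past {d} {T : measurableType d} {R : realType}
    (P : probability T R) (mu : R) (x h : int -> T -> R) : Prop :=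
  exists V : T -> R, measurable_fun setT V /\ P.-integrable setT (EFin \o V) /\
    forall t : int, {ae P, forall w, (fun n => garch_from mu x V n t w) @ \oo --> h t w}.

(* Main.v *)
(** Iterating h_t = mu + x_{t-1} h_{t-1} gives
    h_t = mu sum_{i<n} x_{t-1}...x_{t-i} + x_{t-1}...x_{t-n} h_{t-n}, and by
    independence the i-th product has mean a^i, where a = E x_t.  If a >= 1,
    then E h_t >= mu n for all n.  If a < 1, the series of products has finite
    mean 1 / (1 - a), so almost surely it converges and its terms tend to 0; the
    contribution of the initial value V thus vanishes in the limit whatever its
    dependence on the x_s, and h_t = mu sum_i x_{t-1}...x_{t-i} almost surely.
    The mean of the Gamma law comes from integration by parts; that its
    normalizing constant is finite and nonzero is forced by P having mass 1. *)

Require Import Defs.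
From HB Require Import structures.
From mathcomp Require Import all_boot all_order all_algebra.
From mathcomp Require Import all_classical all_reals all_analysis.
From mathcomp Require Import normal_distribution measurable_realfun ring lra.
Set Implicit Arguments.
Unset Strict Implicit.
Unset Printing Implicit Defensive.
Import Order.TTheory GRing.Theory Num.Theory.
Import numFieldNormedType.Exports HBNNSimple.
Local Open Scope classical_set_scope.
Local Open Scope ring_scope.

(** * Integrals of independent random variables *)

(** A simple function is the finite sum of its values times the indicators of its level sets, and
    the integral is linear. *)
Lemma integral_nnsfun_weight d1 d2 (T : measurableType d1) (U : measurableType d2)
    (R : realType) (m : {measure set T -> \bar R}) (X : T -> U) (Z : T -> R)
    (f : {nnsfun U >-> R}) :
  measurable_fun setT X -> measurable_fun setT Z -> (forall x, 0 <= Z x) ->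
  (\int[m]_x (f (X x) * Z x)%:E =
   \sum_(r \in range f) r%:E * \int[m]_x (\1_(f @^-1` [set r]) (X x) * Z x)%:E)%E.
Proof.
move=> mX mZ Z0.
have mi r : measurable_fun setT (fun x => (\1_(f @^-1` [set r]) (X x) * Z x)%:E).
  apply/measurable_EFinP/measurable_funM => //.
  by apply: (@measurableT_comp _ _ _ _ _ _ (\1_(f @^-1` [set r]) : U -> R)) => //.
have i0 r x : (0 <= (\1_(f @^-1` [set r]) (X x) * Z x)%:E)%E.
  by rewrite lee_fin mulr_ge0.
transitivity (\int[m]_x (\sum_(r \in range f)
    (r%:E * (\1_(f @^-1` [set r]) (X x) * Z x)%:E)))%E.
  apply: eq_integral => x _.
  rewrite fimfunE !fsbig_finite//= big_distrl/= -sumEFin.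
  by apply: eq_bigr => r _; rewrite -EFinM mulrA.
rewrite ge0_integral_fsum//; last first.
- move=> r x _.
  (* Nonnegativity is asked for every real [r]; for negative [r] the level set of [f] is empty and
     the summand vanishes. *)
  have [r0|r0] := leP 0 r; first by rewrite mule_ge0.
  by rewrite preimage_nnfun0// indic0 mul0r mule0.
- by move=> r; apply: measurable_funeM.
apply: eq_fsbigr => r /[!inE] -[u _ <-].
by rewrite ge0_integralZl// lee_fin.
Qed.

(** Agreement on indicators extends to simple functions by linearity and to [g] by monotone
    convergence. Two measures and two weights are allowed so that the same principle serves for
    independence (a weight is replaced by its mean) and for densities ([P] is replaced by Lebesgue
    measure weighted by the density). *)
Lemma eq_integral_weight d1 d2 d3 (T1 : measurableType d1)
    (T2 : measurableType d2) (U : measurableType d3) (R : realType)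
    (m1 : {measure set T1 -> \bar R}) (m2 : {measure set T2 -> \bar R})
    (X1 : T1 -> U) (X2 : T2 -> U) (Z1 : T1 -> R) (Z2 : T2 -> R) :
  measurable_fun setT X1 -> measurable_fun setT X2 ->
  measurable_fun setT Z1 -> measurable_fun setT Z2 ->
  (forall x, 0 <= Z1 x) -> (forall x, 0 <= Z2 x) ->
  (forall A, measurable A ->
    \int[m1]_x (\1_A (X1 x) * Z1 x)%:E = \int[m2]_x (\1_A (X2 x) * Z2 x)%:E)%E ->
  forall g : U -> R, measurable_fun setT g -> (forall u, 0 <= g u) ->
  (\int[m1]_x (g (X1 x) * Z1 x)%:E = \int[m2]_x (g (X2 x) * Z2 x)%:E)%E.
Proof.
move=> mX1 mX2 mZ1 mZ2 Z10 Z20 XZ g mg g0.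
pose f := nnsfun_approx (@measurableT _ U) ((measurable_EFinP _ _).2 mg).
have cvgf d (T : measurableType d) (m : {measure set T -> \bar R}) (X : T -> U)
    (Z : T -> R) : measurable_fun setT X -> measurable_fun setT Z ->
    (forall x, 0 <= Z x) ->
    (\int[m]_x (f n (X x) * Z x)%:E @[n --> \oo] -->
     \int[m]_x (g (X x) * Z x)%:E)%E.
  move=> mX mZ Z0.
  have -> : (\int[m]_x (g (X x) * Z x)%:E =
      \int[m]_x limn (fun n => (f n (X x) * Z x)%:E))%E.
    apply: eq_integral => x _; apply/esym/cvg_lim => //.
    under eq_fun do rewrite EFinM; rewrite EFinM.
    apply: cvgeZr => //.
    apply: (@cvg_nnsfun_approx _ _ _ _ _ _ _ _ (X x) I).
    by move=> u _ /=; rewrite lee_fin.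
  apply: cvg_monotone_convergence => //.
  - move=> n; apply/measurable_EFinP/measurable_funM => //.
    exact: measurableT_comp.
  - by move=> n x _; rewrite lee_fin mulr_ge0.
  - move=> x _ n p np; rewrite lee_fin ler_wpM2r//.
    have /lefP := nd_nnsfun_approx (@measurableT _ U)
      ((measurable_EFinP _ _).2 mg) np.
    exact.
apply: (cvg_unique _ (cvgf _ _ m1 X1 Z1 mX1 mZ1 Z10)) => //.
rewrite (_ : (fun n => _) = (fun n => \int[m2]_x (f n (X2 x) * Z2 x)%:E)%E).
  exact: cvgf.
apply/funext => n; rewrite !integral_nnsfun_weight//.
by apply: eq_fsbigr => r _; rewrite XZ.
Qed.

Section independence_integral.
Context d (T : measurableType d) (R : realType) (P : probability T R).

Lemma integral_mul_cst (X : T -> R) (c : R) :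
  measurable_fun setT X -> (forall x, 0 <= X x) -> 0 <= c ->
  (\int[P]_x (X x * c)%:E = \int[P]_x (X x)%:E * c%:E)%E.
Proof.
move=> mX X0 c0; under eq_integral do rewrite EFinM.
by rewrite ge0_integralZr//; [exact/measurable_EFinP|move=> x _; rewrite lee_fin].
Qed.

Lemma integral_indic_comp d' (U : measurableType d') (X : T -> U) (A : set U) :
  measurable_fun setT X -> measurable A ->
  (\int[P]_x (\1_A (X x))%:E = P (X @^-1` A))%E.
Proof.
move=> mX mA; have mXA : measurable (X @^-1` A).
  by rewrite -[_ @^-1` _]setTI; exact: mX.
have -> : (fun x => (\1_A (X x) : R)%:E) = (fun x => (\1_(X @^-1` A) x : R)%:E).
  by apply/funext => x; rewrite !indicE.
by rewrite integral_indic// setIT.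
Qed.

Lemma indep_integralM d1 d2 (U : measurableType d1) (V : measurableType d2)
    (X : T -> U) (Y : T -> V) (f : U -> R) (g : V -> R) (c : R) :
  measurable_fun setT X -> measurable_fun setT Y ->
  measurable_fun setT f -> measurable_fun setT g ->
  (forall u, 0 <= f u) -> (forall v, 0 <= g v) ->
  (forall A B, measurable A -> measurable B ->
    P (X @^-1` A `&` Y @^-1` B) = P (X @^-1` A) * P (Y @^-1` B))%E ->
  (\int[P]_x (f (X x))%:E = c%:E ->
   \int[P]_x (f (X x) * g (Y x))%:E = c%:E * \int[P]_x (g (Y x))%:E)%E.
Proof.
move=> mX mY mf mg f0 g0 XY cE.
have c0 : 0 <= c.
  by rewrite -lee_fin -cE; apply: integral_ge0 => x _; rewrite lee_fin.
have mfX : measurable_fun setT (fun x => f (X x)) by exact: measurableT_comp mX.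
have mgY : measurable_fun setT (fun x => g (Y x)) by exact: measurableT_comp mY.
have mi d' (W : measurableType d') (Z : T -> W) (A : set W) :
    measurable_fun setT Z -> measurable A ->
    measurable_fun setT (fun x => \1_A (Z x) : R).
  move=> mZ mA; apply: (@measurableT_comp _ _ _ _ _ _ (\1_A : W -> R)) => //.
have step B : measurable B ->
    (\int[P]_x (f (X x) * \1_B (Y x))%:E = c%:E * P (Y @^-1` B))%E.
  move=> mB; have mYB : measurable (Y @^-1` B).
    by rewrite -[_ @^-1` _]setTI; exact: mY.
  rewrite (@eq_integral_weight _ _ _ _ _ _ _ P P X X (fun x => \1_B (Y x))
    (fun=> fine (P (Y @^-1` B))))//; [|exact: mi|by move=> _; exact: fine_ge0|].
    by rewrite (integral_mul_cst mfX) ?fine_ge0// cE fineK// fin_num_measure.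
  move=> A mA; rewrite integral_mul_cst ?fine_ge0//; last exact: mi.
  rewrite integral_indic_comp// fineK ?fin_num_measure// -XY//.
  have mXA : measurable (X @^-1` A) by rewrite -[_ @^-1` _]setTI; exact: mX.
  rewrite -[X in P X]setIT -integral_indic//; last exact: measurableI.
  by apply: eq_integral => x _; rewrite indicI/= !indicE.
under eq_integral do rewrite mulrC.
rewrite (@eq_integral_weight _ _ _ _ _ _ _ P P Y Y (fun x => f (X x)) (fun=> c))//.
  by rewrite integral_mul_cst// muleC.
move=> B mB; rewrite integral_mul_cst//; last exact: mi.
rewrite integral_indic_comp// muleC -step//.
by under eq_integral do rewrite mulrC.
Qed.

End independence_integral.

(** * Products over a mutually independent family *)

Section mutual.
Context d (T : measurableType d) (R : realType) (P : probability T R).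
Context (I : eqType) (X : I -> T -> R).

Lemma prod_indic_comp (J : seq I) (A : I -> set R) x :
  \prod_(i <- J) \1_(A i) (X i x) =
  \1_(\bigcap_(i in [set` J]) (X i @^-1` A i)) x :> R.
Proof.
elim: J => [|i J IH]; first by rewrite big_nil set_nil bigcap_set0 indicT.
have -> : [set` i :: J] = i |` [set` J].
  by apply/seteqP; split=> j /=; rewrite in_cons => /predU1P.
by rewrite big_cons IH bigcap_setU1 indicI.
Qed.

Hypothesis mX : forall i, measurable_fun setT (X i).
Hypothesis indepX : mutually_independent P X.

Lemma mutually_independent_integral_prod (f : I -> R -> R) (c : I -> R) :
  (forall i, measurable_fun setT (f i)) -> (forall i x, 0 <= f i x) ->
  (forall i, \int[P]_x (f i (X i x))%:E = (c i)%:E)%E ->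
  forall J, uniq J ->
  (\int[P]_x (\prod_(i <- J) f i (X i x))%:E = (\prod_(i <- J) c i)%:E)%E.
Proof.
move=> mf f0 cE J uJ.
have c0 i : 0 <= c i.
  by rewrite -lee_fin -cE; apply: integral_ge0 => x _; rewrite lee_fin.
pose p i A := fine (P (X i @^-1` A)).
have p0 i A : 0 <= p i A by exact: fine_ge0.
have mXA i A : measurable A -> measurable (X i @^-1` A).
  by move=> mA; rewrite -[_ @^-1` _]setTI; exact: mX.
have mi i A : measurable A -> measurable_fun setT (fun x => \1_A (X i x) : R).
  by move=> mA; apply: (@measurableT_comp _ _ _ _ _ _ (\1_A : R -> R)).
(* The indicators are replaced by the f i one index at a time. *)
suff main J1 J2 (A : I -> set R) : uniq (J1 ++ J2) ->
    (forall i, measurable (A i)) ->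
    (\int[P]_x (\prod_(i <- J1) f i (X i x) *
                \prod_(i <- J2) \1_(A i) (X i x))%:E =
     (\prod_(i <- J1) c i * \prod_(i <- J2) p i (A i))%:E)%E.
  have := main J [::] (fun=> set0); rewrite cats0 big_nil mulr1 => <-//.
  by apply: eq_integral => x _; rewrite big_nil mulr1.
elim: J1 J2 A => [|i J1 IH] J2 A.
  rewrite cat0s => uJ2 mA; rewrite big_nil mul1r.
  under eq_integral do rewrite big_nil mul1r prod_indic_comp.
  rewrite integral_indic// ?setIT//.
    rewrite [LHS](indepX uJ2 mA) -prodEFin; apply: eq_bigr => i _.
    by rewrite /p fineK// fin_num_measure//; exact: mXA.
  by apply: fin_bigcap_measurable; [exact: finite_seq|move=> i _; exact: mXA].
rewrite cat_cons => uJ12 mA.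
under eq_integral do rewrite big_cons -mulrA.
pose C := \prod_(i <- J1) c i * \prod_(i <- J2) p i (A i).
have C0 : 0 <= C by rewrite mulr_ge0// prodr_ge0.
pose Z x := \prod_(i <- J1) f i (X i x) * \prod_(i <- J2) \1_(A i) (X i x).
(* All other factors form the weight [Z] of [f i (X i x)]. Replacing [Z] by its mean [C] is
   justified on indicators of [X i] by the induction hypothesis, with [i] moved to the list of
   indicators. *)
rewrite (@eq_integral_weight _ _ _ _ _ _ _ P P (X i) (X i) Z (fun=> C))//.
- rewrite integral_mul_cst//; first by rewrite cE -EFinM mulrA big_cons.
  exact: measurableT_comp.
- apply: measurable_funM; apply: measurable_prod => j _; last exact: mi.
  exact: measurableT_comp.
- by move=> x; rewrite mulr_ge0// prodr_ge0.
move=> B mB; rewrite integral_mul_cst//; last exact: mi.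
rewrite integral_indic_comp//.
(* The set [B] is inserted at index [i]; since [i] does not occur in [J2], the other indicators are
   unchanged. *)
pose A' j := if j == i then B else A j.
have iJ : i \notin J1 ++ J2 by case/andP: uJ12.
have A'E j : j \in J2 -> A' j = A j.
  rewrite /A'; case: eqP => // ->.
  by move: iJ; rewrite mem_cat negb_or => /andP[_ /negbTE ->].
have := IH (i :: J2) A'.
rewrite -(cat1s i) uniq_catCA cat1s => /(_ uJ12).
have mA' j : measurable (A' j) by rewrite /A'; case: ifP.
move=> /(_ mA').
have pE : \prod_(j <- J2) p j (A' j) = \prod_(j <- J2) p j (A j).
  by apply: eq_big_seq => j jJ2; rewrite A'E.
have iE x : \prod_(j <- J2) \1_(A' j) (X j x) =
    \prod_(j <- J2) \1_(A j) (X j x) :> R.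
  by apply: eq_big_seq => j jJ2; rewrite A'E.
have A'i : A' i = B by rewrite /A' eqxx.
rewrite big_cons pE A'i mulrCA -/C EFinM {1}/p fineK; last first.
  by apply: fin_num_measure; exact: mXA.
by move=> <-; apply: eq_integral => x _; rewrite big_cons iE A'i mulrCA.
Qed.

End mutual.

(** * Moments of the normal and Gamma laws *)

Section density.
Context (R : realType).
Local Notation leb := (@lebesgue_measure R).

Lemma integral_indic_mul (q : R -> R) (A : set R) :
  (\int[leb]_x (\1_A x * q x)%:E = \int[leb]_(x in A) (q x)%:E)%E.
Proof.
rewrite [RHS]integral_mkcond; apply: eq_integral => x _.
by rewrite patchE indicE; case: ifPn; rewrite ?mul1r ?mul0r.
Qed.

(** Exchange of weights between [P] with weight 1 and Lebesgue measure with weight [q]; the law of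
    [X] is exactly the agreement on indicators. *)
Lemma integral_density d (T : measurableType d) (P : probability T R)
    (X : T -> R) (q g : R -> R) :
  measurable_fun setT X -> measurable_fun setT q -> (forall x, 0 <= q x) ->
  (forall A, measurable A -> P (X @^-1` A) = \int[leb]_(x in A) (q x)%:E)%E ->
  measurable_fun setT g -> (forall x, 0 <= g x) ->
  (\int[P]_x (g (X x))%:E = \int[leb]_x (g x * q x)%:E)%E.
Proof.
move=> mX mq q0 law mg g0.
under eq_integral do rewrite -[g (X _)]mulr1.
apply: (@eq_integral_weight _ _ _ _ _ _ _ P leb X id (fun=> 1) q) => // A mA.
under eq_integral do rewrite mulr1.
by rewrite integral_indic_comp// integral_indic_mul law.
Qed.

End density.

(** * Absolute, positive and negative first moments of the standard normal law *)

Section normal_moments.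
Context (R : realType).
Local Notation leb := (@lebesgue_measure R).
Local Notation phi := (@normal_pdf R 0 1).
Local Notation c := (@normal_peak R 1).

Lemma std_normal_pdfE : phi = fun x => c * expR (- (x ^+ 2 / 2)).
Proof.
by rewrite normal_pdfE ?oner_neq0//; apply/funext => x;
  rewrite /normal_fun subr0 expr1n mulNr.
Qed.

(** Makes [- phi x] an antiderivative of [x * phi x], from which the half-line moment follows by the
    fundamental theorem of calculus. *)
Lemma is_derive_std_normal_pdf (x : R) : is_derive x 1 phi (- (x * phi x)).
Proof.
rewrite std_normal_pdfE.
have d2 : is_derive x 1 (fun y : R => - (y ^+ 2 / 2)) (- x).
  apply: is_derive_eq; rewrite /GRing.scale/=.
  by field.
have de : is_derive x 1 (fun y : R => expR (- (y ^+ 2 / 2)))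
    (expR (- (x ^+ 2 / 2)) * - x).
  exact: is_derive1_comp.
apply: is_derive_eq; rewrite /GRing.scale/=.
by ring.
Qed.

Lemma cvg_std_normal_pdf : phi x @[x --> +oo] --> (0 : R).
Proof.
rewrite std_normal_pdfE -[0](mulr0 c); apply: cvgM; first exact: cvg_cst.
apply: (cvg_comp (fun x : R => x ^+ 2 / 2) (fun x => expR (- x)));
  last exact: cvgr_expR.
by apply: gt0_cvgMly => //; exact: cvgr_expr2.
Qed.

Lemma std_normal_pdf_center : phi 0 = c.
Proof. by rewrite std_normal_pdfE expr0n/= mul0r oppr0 expR0 mulr1. Qed.

Lemma integral_std_normal_half :
  (\int[leb]_(x in [set x | (0 <= x)%R]) (x * phi x)%:E = c%:E)%E.
Proof.
rewrite -set_itvcy (@ge0_continuous_FTC2y _ _ (fun x => - phi x) 0 0).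
- by rewrite std_normal_pdf_center EFinN oppeK add0e.
- by move=> x x0; rewrite mulr_ge0// normal_pdf_ge0.
- apply: continuous_subspaceT => x; apply: cvgM; first exact: cvg_id.
  by apply: continuous_normal_pdf; exact: oner_neq0.
- rewrite -[X in _ --> X]oppr0; apply: cvgN; exact: cvg_std_normal_pdf.
- by move=> x _; apply: derivableN; apply: ex_derive;
    exact: is_derive_std_normal_pdf.
- apply/cvg_at_right_filter; apply: cvgN.
  by apply: continuous_normal_pdf; exact: oner_neq0.
- move=> x _; rewrite derive1E deriveN; last first.
    by apply: ex_derive; exact: is_derive_std_normal_pdf.
  by have [_ ->] := is_derive_std_normal_pdf x; rewrite opprK.
Qed.

Lemma integral_std_normal_pos :
  (\int[leb]_x (Num.max x 0 * phi x)%:E = c%:E)%E.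
Proof.
rewrite -integral_std_normal_half [RHS]integral_mkcond.
apply: eq_integral => x _; rewrite patchE; case: ifPn; rewrite ?inE ?notin_setE/=.
  by move=> /max_l ->.
by move=> /negP; rewrite -ltNge => /ltW/max_r ->; rewrite mul0r.
Qed.

Lemma integral_std_normal_abs :
  (\int[leb]_x (`|x| * phi x)%:E = (2 * c)%:E)%E.
Proof.
rewrite ge0_symfun_integralT.
- rewrite EFinM -integral_std_normal_half; congr (_ * _)%E.
  by apply: eq_integral => x; rewrite inE/= => /ger0_norm ->.
- by move=> x; rewrite mulr_ge0// normal_pdf_ge0.
- move=> x; apply: cvgM; first exact: norm_continuous.
  by apply: continuous_normal_pdf; exact: oner_neq0.
- by move=> x; rewrite std_normal_pdfE/= normrN sqrrN.
Qed.

Context d (T : measurableType d) (P : probability T R) (X : T -> R).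
Hypothesis mX : measurable_fun setT X.
Hypothesis lawX : forall A, measurable A -> P (X @^-1` A) = normal_prob 0 1 A.

Let expectation_std_normal (g : R -> R) :
  measurable_fun setT g -> (forall x, 0 <= g x) ->
  (\int[P]_x (g (X x))%:E = \int[leb]_x (g x * phi x)%:E)%E.
Proof.
apply: integral_density => //; first exact: measurable_normal_pdf.
by move=> x; exact: normal_pdf_ge0.
Qed.

Lemma expectation_std_normal_pos :
  (\int[P]_x (Num.max (X x) 0)%:E = c%:E)%E.
Proof.
rewrite (@expectation_std_normal (fun x => Num.max x 0)).
- exact: integral_std_normal_pos.
- exact: measurable_maxr.
- by move=> x; rewrite le_max lexx orbT.
Qed.

Lemma double_normal_peak : 2 * c = Num.sqrt (2 / pi).
Proof.
suff sqrtE (p : R) : 0 < p -> 2 * (Num.sqrt (p *+ 2))^-1 = Num.sqrt (2 / p).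
  by rewrite /normal_peak expr1n mul1r sqrtE// pi_gt0.
move=> p0; apply/eqP.
rewrite -(@eqrXn2 _ 2) ?sqrtr_ge0// ?mulr_ge0 ?invr_ge0 ?sqrtr_ge0//.
rewrite exprMn exprVn !sqr_sqrtr ?mulrn_wge0 ?divr_ge0 ?(ltW p0)//.
by apply/eqP; field; rewrite gt_eqF.
Qed.

Lemma expectation_std_normal_abs :
  (\int[P]_x `|X x|%:E = (Num.sqrt (2 / pi))%:E)%E.
Proof.
rewrite (@expectation_std_normal Num.norm)//.
by rewrite integral_std_normal_abs double_normal_peak.
Qed.

(** The absolute value is the sum of the positive and negative parts; its mean is [2 * c] and the
    positive part has mean [c], so [c] remains. *)
Lemma expectation_std_normal_neg :
  (\int[P]_x (Num.max (- X x) 0)%:E = c%:E)%E.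
Proof.
have := expectation_std_normal_abs; rewrite -double_normal_peak.
have -> : (fun x => `|X x|%:E) =
    (fun x => (Num.max (X x) 0)%:E + (Num.max (- X x) 0)%:E)%E.
  apply/funext => x; rewrite -EFinD; congr EFin.
  have /orP[X0|X0] := le_total 0 (X x).
    by rewrite ger0_norm// max_l// max_r ?addr0// oppr_le0.
  by rewrite ler0_norm// max_r// max_l ?add0r// oppr_ge0.
rewrite ge0_integralD//.
- rewrite expectation_std_normal_pos mulrDl mul1r EFinD.
  (* Cancellation takes place in the extended reals: an infinite integral would contradict the
     finite total. *)
  by case: (integral _ _ _) => [r| |]// [] /addrI ->.
- by move=> x _; rewrite lee_fin le_max lexx orbT.
- by apply/measurable_EFinP/measurable_maxr.
- by move=> x _; rewrite lee_fin le_max lexx orbT.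
- by apply/measurable_EFinP/measurable_maxr => //; exact: measurableT_comp.
Qed.

End normal_moments.

(** * First moment and positivity of the Gamma law *)

Section gamma_moment.
Context (R : realType).
Local Notation leb := (@lebesgue_measure R).

(** Left end of the intervals from [1 / (n + 2)] to [n + 2] that exhaust the positive half-line; the
    shift by 2 keeps them nondegenerate already at [n = 0]. *)
Let a n : R := (n.+2%:R)^-1.

Let a_gt0 n : 0 < a n. Proof. by rewrite invr_gt0 ltr0n. Qed.

Let a_lt n : a n < n.+2%:R.
Proof. by rewrite (@lt_trans _ _ 1)// ?invf_lt1 ?ltr0n ?ltr1n. Qed.

Let cvg_a : a n @[n --> \oo] --> (0 : R).
Proof. by have := @cvg_harmonic R; rewrite -cvg_shiftS. Qed.

Let cvg_a_powR (k : R) : 0 < k -> a n `^ k @[n --> \oo] --> (0 : R).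
Proof.
move=> /powR_cvg0/(cvg_at_rightP (fun x => x `^ k) 0 0).1; apply.
by split => // n; exact: a_gt0.
Qed.

(** Write [b = n + 2]. Raising [z <= expR z] at [z = b / (2 * k)] to the power [2 * k] bounds
    [expR b] below by a multiple of [b] to the power [2 * k], twice the exponent to be beaten. This
    controls the boundary term at the right end. *)
Let powR_expRN_bound (k : R) n : 0 < k ->
  n.+2%:R `^ k * expR (- n.+2%:R) <= (2 * k) `^ (2 * k) * a n `^ k :> R.
Proof.
move=> k0; set b : R := n.+2%:R.
have b0 : 0 < b by rewrite ltr0n.
have k20 : 0 < 2 * k by rewrite mulr_gt0.
have z0 : 0 < b / (2 * k) by rewrite divr_gt0.
have : (b / (2 * k)) `^ (2 * k) <= expR b.
  rewrite -[in leRHS](divfK (lt0r_neq0 k20) b) expRM.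
  apply: ge0_ler_powR; rewrite ?nnegrE ?expR_ge0 ?(ltW z0) ?(ltW k20)//.
  by rewrite (le_trans _ (expR_ge1Dx _))// lerDr.
move=> bE; rewrite expRN ler_pdivrMr ?expR_gt0//.
apply: le_trans (ler_wpM2l _ bE); last by rewrite mulr_ge0 ?powR_ge0.
rewrite mulrAC -powRM ?(ltW k20) ?(ltW z0)// mulrC mulrC.
rewrite [2 * k * _]mulrC divfK ?lt0r_neq0// [2 * k]mulr_natl mulr2n.
rewrite powRD; last by rewrite (gt_eqF b0) implybT.
by rewrite -mulrA -powRM ?(ltW b0) ?(ltW (a_gt0 n))// divff ?gt_eqF// powR1 mulr1.
Qed.

(** The functional equation of the Gamma function: integration by parts on compact intervals, whose
    boundary terms vanish in the limit, followed by monotone passage to the half-line. As an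
    identity of extended reals it can be used before the Gamma integral is known to be finite. *)
Lemma integral_powR_expRN_succ (k : R) : 0 < k ->
  (\int[leb]_(x in `]0%R, +oo[) (x `^ k * expR (- x))%:E =
   k%:E * \int[leb]_(x in `]0%R, +oo[) (x `^ (k - 1) * expR (- x))%:E)%E.
Proof.
move=> k0.
pose D n : set R := [set` `[a n, n.+2%:R]].
have DU : \bigcup_n D n = `]0, +oo[%classic.
  apply/seteqP; split=> [x [n _]|x] /=; rewrite !in_itv/= ?andbT.
    by case/andP=> /(lt_le_trans (a_gt0 n)).
  (* This index plus one exceeds both [x] and its inverse, so [x] lies between the two ends of
     [D]. *)
  move=> x0; exists (Num.truncn (x + x^-1)) => //; rewrite /D/= in_itv/=.
  have : x + x^-1 < (Num.truncn (x + x^-1)).+1%:R by exact: truncnS_gt.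
  set m := Num.truncn _ => h.
  have mm : m.+1%:R <= m.+2%:R :> R by rewrite ler_nat.
  apply/andP; split; last by have := invr_gt0 x; rewrite x0; lra.
  rewrite /a -[leRHS]invrK lef_pV2 ?posrE ?invr_gt0 ?ltr0n//; lra.
have ndD : nondecreasing_seq D.
  move=> m n mn; rewrite /D; apply/subsetPset/subset_itv; rewrite bnd_simp.
    by rewrite /a lef_pV2 ?posrE ?ltr0n// ler_nat !ltnS.
  by rewrite ler_nat !ltnS.
have mD n : measurable (D n) by exact: measurable_itv.
have cvgD (f : R -> R) : measurable_fun setT f -> (forall x, 0 <= f x) ->
    (\int[leb]_(x in D n) (f x)%:E @[n --> \oo] -->
     \int[leb]_(x in `]0%R, +oo[) (f x)%:E)%E.
  move=> mf f0; rewrite -DU; apply: ge0_nondecreasing_set_cvg_integral => //.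
  - by move=> n; apply/measurable_EFinP/measurable_funTS.
  - by move=> n x _; rewrite lee_fin.
have mpe r : measurable_fun setT (fun x : R => x `^ r * expR (- x)).
  apply: measurable_funM; first exact: measurable_powR.
  by apply: measurableT_comp.
have pe0 r (x : R) : 0 <= x `^ r * expR (- x) by rewrite mulr_ge0// powR_ge0.
pose c n : R := a n `^ k * expR (- a n) - n.+2%:R `^ k * expR (- n.+2%:R).
have step n : (\int[leb]_(x in D n) (x `^ k * expR (- x))%:E =
    (c n)%:E + k%:E * \int[leb]_(x in D n) (x `^ (k - 1) * expR (- x))%:E)%E.
  have posD x : x \in `[a n, n.+2%:R] -> 0 < x.
    by rewrite in_itv/= => /andP[/(lt_le_trans (a_gt0 n))].
  have dE (x : R) : is_derive x 1 (fun x : R => - expR (- x)) (expR (- x)).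
    have : is_derive x 1 (fun x : R => expR (- x)) (expR (- x) * - 1).
      exact: is_derive1_comp.
    by move=> ?; apply: is_derive_eq; ring.
  have cE : continuous (fun x : R => expR (- x)).
    move=> x; apply: (continuous_comp (@oppr_continuous _ _ x)).
    exact: continuous_expR.
  have cP r (x : R) : 0 < x -> {for x, continuous (@powR R ^~ r)}.
    move=> x0; apply: differentiable_continuous; apply/derivable1_diffP.
    by apply: ex_derive; exact: is_derive1_powR.
  rewrite (@integration_by_parts _ (fun x => x `^ k) (fun x => - expR (- x))
    (fun x => k * x `^ (k - 1)) (fun x => expR (- x)))//.
  - have -> : (fun x : R => (k * x `^ (k - 1) * - expR (- x))%:E) =
        (fun x => - (k%:E * (x `^ (k - 1) * expR (- x))%:E))%E.
      by apply/funext => x; rewrite -EFinM -EFinN; congr EFin; ring.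
    rewrite integral_ge0N; last by move=> x _; rewrite mule_ge0 ?lee_fin ?(ltW k0).
    rewrite oppeK ge0_integralZl ?lee_fin ?(ltW k0)//.
    + by congr (_%:E + _)%E; rewrite /c; ring.
    + by apply/measurable_EFinP/measurable_funTS; exact: mpe.
    + by move=> x _; rewrite lee_fin; exact: pe0.
  - apply: continuous_in_subspaceT => x; rewrite inE/= => /posD x0.
    by apply: cvgM; [exact: cvg_cst|exact: cP].
  - split.
    + by move=> x /subset_itv_oo_cc/posD x0; apply: ex_derive;
        exact: is_derive1_powR.
    + apply/cvg_at_right_filter; apply: cP; exact: a_gt0.
    + by apply/cvg_at_left_filter; apply: cP; rewrite ltr0n.
  - move=> x /subset_itv_oo_cc/posD x0; rewrite derive1E.
    by have [_ ->] := is_derive1_powR k x0.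
  - exact: continuous_subspaceT.
  - split.
    + by move=> x _; apply: ex_derive; exact: dE.
    + by apply/cvg_at_right_filter; apply: cvgN; exact: cE.
    + by apply/cvg_at_left_filter; apply: cvgN; exact: cE.
  - by move=> x _; rewrite derive1E; have [_ ->] := dE x.
have c0 : c n @[n --> \oo] --> (0 : R).
  rewrite -[X in _ --> X]subr0; apply: cvgB.
  - apply: (@squeeze_cvgr _ _ _ _ (fun=> 0) (fun n => a n `^ k)); last 2 first.
      exact: cvg_cst.
      exact: cvg_a_powR.
    apply: nearW => m; rewrite pe0/= ler_piMr ?powR_ge0// expR_le1 oppr_le0.
    exact: ltW.
  - apply: (@squeeze_cvgr _ _ _ _ (fun=> 0)
      (fun n => (2 * k) `^ (2 * k) * a n `^ k)); last 2 first.
      exact: cvg_cst.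
      rewrite -[X in _ --> X](mulr0 ((2 * k) `^ (2 * k))); apply: cvgM.
        exact: cvg_cst.
      exact: cvg_a_powR.
    by apply: nearW => m; rewrite pe0/= powR_expRN_bound.
apply: (cvg_unique _ (cvgD _ (mpe k) (pe0 k))) => //.
rewrite (funext step).
rewrite -[(k%:E * _)%E]add0e; apply: cvgeD => //.
  by apply: cvg_EFin; [exact: nearW|exact: c0].
by apply: cvgeZl => //; exact: cvgD.
Qed.

Context d (T : measurableType d) (P : probability T R) (X : T -> R) (k : R).
Hypothesis k_gt0 : 0 < k.
Hypothesis mX : measurable_fun setT X.
Hypothesis lawX : forall A, measurable A -> P (X @^-1` A) = gamma_prob k A.

Let G := Gamma_fun k.
Let f (x : R) := x `^ (k - 1) * expR (- x).

Let f_ge0 x : 0 <= f x. Proof. by rewrite mulr_ge0 ?powR_ge0 ?expR_ge0. Qed.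

Let mf : measurable_fun setT f.
Proof.
by apply: measurable_funM; [exact: measurable_powR|exact: measurableT_comp].
Qed.

Let G_ge0 : 0 <= G.
Proof.
apply: fine_ge0; apply: integral_ge0 => x _.
by rewrite lee_fin; exact: f_ge0.
Qed.

Let gamma_pdf_ge0 x : 0 <= gamma_pdf k x.
Proof.
rewrite /gamma_pdf; case: ifPn => // _.
by apply: divr_ge0; [exact: f_ge0|exact: G_ge0].
Qed.

Let gamma_pdfE : gamma_pdf k = (fun x => G^-1 * (f \_ `]0, +oo[%classic) x).
Proof.
apply/funext => x; rewrite /gamma_pdf patchE.
have xE : (x \in `]0, +oo[%classic) = (0 < x).
  by rewrite mem_setE in_itv/= andbT.
by rewrite xE; case: ifP => _; rewrite ?mulr0// mulrC.
Qed.

Let measurable_gamma_pdf : measurable_fun setT (gamma_pdf k).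
Proof.
rewrite gamma_pdfE; apply: measurable_funM => //.
by apply/(measurable_restrictT f) => //; exact: measurable_funTS.
Qed.

Let integral_gamma_pdf_mul (g : R -> R) :
  measurable_fun setT g -> (forall x, 0 <= g x) ->
  (\int[leb]_x (g x * gamma_pdf k x)%:E =
   G^-1%:E * \int[leb]_(x in `]0%R, +oo[) (g x * f x)%:E)%E.
Proof.
move=> mg g0; rewrite -ge0_integralZl//.
- rewrite [RHS]integral_mkcond; apply: eq_integral => x _.
  rewrite gamma_pdfE !patchE.
  by case: ifPn => _; rewrite ?mulr0// -EFinM mulrCA.
- by apply/measurable_EFinP/measurable_funTS/measurable_funM.
- by move=> x _; rewrite lee_fin mulr_ge0.
- by rewrite lee_fin invr_ge0.
Qed.

(** [Gamma_fun] is defined through [fine], so a divergent integral would give [G = 0] and a zero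
    density. The total mass 1 of [P] excludes this and gives the normalization directly. *)
Let integral_gamma_pdf : (G^-1%:E * \int[leb]_(x in `]0%R, +oo[) (f x)%:E = 1)%E.
Proof.
have := lawX measurableT; rewrite preimage_setT probability_setT /gamma_prob => ->.
have := @integral_gamma_pdf_mul (fun=> 1) (measurable_cst _) (fun=> ler01).
by under eq_integral do rewrite mul1r; under [in RHS]eq_integral do rewrite mul1r.
Qed.

(** On the positive half-line the factor [x] raises the exponent [k - 1] to [k]; the functional
    equation extracts [k], and the normalization gives 1 for the rest. *)
Lemma expectation_gamma_abs : (\int[P]_x `|X x|%:E = k%:E)%E.
Proof.
rewrite (@integral_density _ _ _ P X (gamma_pdf k) Num.norm)//.
rewrite integral_gamma_pdf_mul//.
transitivity (G^-1%:E * \int[leb]_(x in `]0%R, +oo[) (x `^ k * expR (- x))%:E)%E.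
  congr (_ * _)%E; apply: eq_integral => x; rewrite inE/= in_itv/= andbT => x0.
  rewrite ger0_norm ?(ltW x0)// /f mulrA -[X in X * _ * _](@powRr1 _ x) ?(ltW x0)//.
  by rewrite -powRD ?(gt_eqF x0) ?implybT// addrC subrK.
by rewrite integral_powR_expRN_succ// muleCA integral_gamma_pdf mule1.
Qed.

Lemma gamma_ge0_ae : {ae P, forall x, 0 <= X x}.
Proof.
exists (X @^-1` `]-oo, 0[); split.
- by rewrite -[_ @^-1` _]setTI; exact: mX.
- rewrite lawX// /gamma_prob integral0_eq// => x /=; rewrite in_itv/= => x0.
  by rewrite /gamma_pdf ltNge (ltW x0).
- by move=> x /= /negP; rewrite in_itv/= ltNge.
Qed.

End gamma_moment.

(** * Products of lagged coefficients *)

Section lag_product.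
Context {T : Type} {R : realType}.
Implicit Type x : int -> T -> R.

(** The product of [x] over the times [t - 1], ..., [t - n]. *)
Fixpoint lag_prod x (n : nat) (t : int) (w : T) : R :=
  if n is n'.+1 then x (t - 1) w * lag_prod x n' (t - 1) w else 1.

Lemma lag_prod_ge0 x n t w : (forall s, 0 <= x s w) -> 0 <= lag_prod x n t w.
Proof. by move=> x0; elim: n t => //= n IH t; rewrite mulr_ge0. Qed.

Lemma eq_lag_prod x y n t w :
  (forall s, x s w = y s w) -> lag_prod x n t w = lag_prod y n t w.
Proof. by move=> xy; elim: n t => //= n IH t; rewrite xy IH. Qed.

(** Valid pointwise for any [V]: used with [V = h (t - n)] for a lower bound and with the value from
    the infinite past for the limit. *)
Lemma garch_from_lag_prod mu x V n t w : garch_from mu x V n t w =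
  mu * (\sum_(0 <= i < n) lag_prod x i t w) + lag_prod x n t w * V w.
Proof.
elim: n t => /= [|n IH] t; first by rewrite big_geq// mulr0 add0r mul1r.
rewrite IH big_nat_recl//=.
under [in RHS]eq_bigr do rewrite /=.
by rewrite -mulr_sumr; ring.
Qed.

Lemma garch_from_fixpoint mu x (h : int -> T -> R) n t w :
  (forall s, h s w = mu + x (s - 1) w * h (s - 1) w) ->
  h t w = garch_from mu x (h (t - n%:Z)) n t w.
Proof.
move=> hE; elim: n t => [|n IH] t /=; first by rewrite subr0.
by rewrite hE (IH (t - 1)) -addrA -opprD -(intS n).
Qed.

End lag_product.

Lemma measurable_lag_prod d (T : measurableType d) (R : realType)
    (x : int -> T -> R) n t :
  (forall s, measurable_fun setT (x s)) -> measurable_fun setT (lag_prod x n t).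
Proof. by move=> mx; elim: n t => //= n IH t; apply: measurable_funM. Qed.

(** * Means of the lagged products *)

Section garch_moments.
Context d (T : measurableType d) (R : realType) (P : probability T R).
Context (alpha beta gamma me k : R) (eps eta : int -> T -> R).
Hypotheses (alpha0 : 0 <= alpha) (beta0 : 0 <= beta) (gamma0 : 0 <= gamma).
Hypothesis meps : forall t, measurable_fun setT (eps t).
Hypothesis meta : forall t, measurable_fun setT (eta t).
Hypothesis E_eps : forall t, (\int[P]_x `|eps t x|%:E = me%:E)%E.
Hypothesis E_eta : forall t, (\int[P]_x `|eta t x|%:E = k%:E)%E.
Hypothesis indep : mutually_independent P
  (fun i : int + int => match i with inl t => eps t | inr t => eta t end).

Let X (i : int + int) := match i with inl t => eps t | inr t => eta t end.
Let m (i : int + int) := match i with inl _ => me | inr _ => k end.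
Let time (i : int + int) := match i with inl t => t | inr t => t end.
(* Agrees with xproc almost surely, but is nonnegative everywhere. *)
Let y := xproc alpha beta gamma eps (fun t w => `|eta t w|).
Let a := alpha * me + beta * k + gamma.

Let y_ge0 t w : 0 <= y t w.
Proof. by rewrite /y /xproc !addr_ge0 ?mulr_ge0. Qed.

Let mX i : measurable_fun setT (X i). Proof. by case: i. Qed.

Let my t : measurable_fun setT (y t).
Proof.
apply: measurable_funD => //; apply: measurable_funD; apply: measurable_funM => //.
  exact: measurableT_comp.
exact: measurableT_comp.
Qed.

(** The extra factors indexed by [J] make the induction close: expanding the factor of time [t - 1]
    adds to [J] an index for [eps], an index for [eta], or nothing. As [J] holds only times from [t]
    on, the new index is fresh, and finally mutual independence applies to a list without
    repetition. *)
Let integral_lag_prod_abs n t (J : seq (int + int)) :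
  uniq J -> (forall i, i \in J -> t <= time i) ->
  (\int[P]_w (lag_prod y n t w * \prod_(i <- J) `|X i w|)%:E =
   (a ^+ n * \prod_(i <- J) m i)%:E)%E.
Proof.
elim: n t J => [|n IH] t J uJ tJ.
  under eq_integral do rewrite mul1r.
  rewrite (@mutually_independent_integral_prod _ _ _ _ _ X _ _
    (fun=> Num.norm) m) ?mul1r//.
  by case.
have tJ' i : i \in J -> t - 1 <= time i.
  by move=> /tJ; apply: le_trans; rewrite gerBl.
have ltJ i : time i = t - 1 -> i \notin J.
  by move=> it; apply/negP => /tJ; rewrite it lerBrDr gerDl.
pose F J w := lag_prod y n (t - 1) w * \prod_(i <- J) `|X i w|.
have F0 J0 w : 0 <= F J0 w.
  by rewrite mulr_ge0 ?prodr_ge0 ?lag_prod_ge0.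
have mF J0 : measurable_fun setT (EFin \o F J0).
  apply/measurable_EFinP/measurable_funM; first exact: measurable_lag_prod.
  by apply: measurable_prod => i _; apply: measurableT_comp.
have F1 i : time i = t - 1 ->
    (\int[P]_w (F (i :: J) w)%:E = (a ^+ n * (m i * \prod_(i <- J) m i))%:E)%E.
  move=> it; rewrite IH ?big_cons//= ?ltJ//.
  by move=> j; rewrite in_cons => /predU1P[->|/tJ'//]; rewrite it.
transitivity (\int[P]_w (alpha%:E * (F (inl (t - 1) :: J) w)%:E +
    beta%:E * (F (inr (t - 1) :: J) w)%:E + gamma%:E * (F J w)%:E))%E.
  apply: eq_integral => w _; rewrite -!EFinM -!EFinD; congr EFin.
  by rewrite /F !big_cons /= /y /xproc; ring.
have aF c J0 : 0 <= c -> (forall w, 0 <= c%:E * (F J0 w)%:E)%E.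
  by move=> c0 w; rewrite lee_fin mulr_ge0.
rewrite ge0_integralD//; last 4 first.
- by move=> w _; rewrite adde_ge0 ?aF.
- by apply: emeasurable_funD; apply: measurable_funeM; exact: mF.
- by move=> w _; rewrite aF.
- by apply: measurable_funeM; exact: mF.
rewrite ge0_integralD//; last 4 first.
- by move=> w _; rewrite aF.
- by apply: measurable_funeM; exact: mF.
- by move=> w _; rewrite aF.
- by apply: measurable_funeM; exact: mF.
have ZF c J0 : 0 <= c ->
    (\int[P]_w (c%:E * (F J0 w)%:E) = c%:E * \int[P]_w (F J0 w)%:E)%E.
  move=> c0; rewrite ge0_integralZl//; first exact: mF.
  by move=> w _; rewrite lee_fin.
rewrite !ZF// !F1// IH// -!EFinM -!EFinD; congr EFin.
by rewrite /= exprS /a; ring.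
Qed.

Lemma integral_lag_prod n t : (\int[P]_w (lag_prod y n t w)%:E = (a ^+ n)%:E)%E.
Proof.
have := @integral_lag_prod_abs n t [::] erefl.
rewrite big_nil mulr1 => <-//.
by apply: eq_integral => w _; rewrite big_nil mulr1.
Qed.

End garch_moments.

(** * Mean of the solution of the random recurrence *)

Section random_recurrence.
Context d (T : measurableType d) (R : realType) (P : probability T R).
Context (mu a : R) (x y h : int -> T -> R).
Hypothesis mu0 : 0 < mu.
Hypothesis my : forall t, measurable_fun setT (y t).
Hypothesis mh : forall t, measurable_fun setT (h t).
Hypothesis y0 : forall t w, 0 <= y t w.
Hypothesis h0 : forall t w, 0 < h t w.
Hypothesis xy : {ae P, forall w, forall t, x t w = y t w}.
Hypothesis hE : forall t w, h t w = mu + x (t - 1) w * h (t - 1) w.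
Hypothesis E_y : forall n t, (\int[P]_w (lag_prod y n t w)%:E = (a ^+ n)%:E)%E.

Let a0 : 0 <= a.
Proof.
rewrite -lee_fin -(expr1 a) -(E_y 1 0); apply: integral_ge0 => w _.
by rewrite lee_fin lag_prod_ge0.
Qed.

Let mlag n t : measurable_fun setT (fun w => (lag_prod y n t w)%:E).
Proof. by apply/measurable_EFinP; exact: measurable_lag_prod. Qed.

(** Unrolling [n] steps from the actual value [h (t - n)] leaves a nonnegative remainder, so the
    truncated series bounds [h t] from below almost surely. *)
Let sum_lag_prod_le n t :
  ((mu * \sum_(0 <= i < n) a ^+ i)%:E <= \int[P]_w (h t w)%:E)%E.
Proof.
have -> : ((mu * \sum_(0 <= i < n) a ^+ i)%:E =
    \int[P]_w (mu%:E * \sum_(0 <= i < n) (lag_prod y i t w)%:E))%E.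
  rewrite ge0_integralZl//.
  - rewrite ge0_integral_sum//; last by move=> i w _; rewrite lee_fin lag_prod_ge0.
    by rewrite EFinM -sumEFin; congr (_ * _)%E; apply: eq_bigr => i _; rewrite E_y.
  - exact: emeasurable_sum.
  - by move=> w _; apply: sume_ge0 => i _; rewrite lee_fin lag_prod_ge0.
  - by rewrite lee_fin ltW.
apply: ae_ge0_le_integral => //.
- move=> w _; rewrite mule_ge0 ?lee_fin ?(ltW mu0)//.
  by apply: sume_ge0 => i _; rewrite lee_fin lag_prod_ge0.
- by apply: measurable_funeM; exact: emeasurable_sum.
- by move=> w _; rewrite lee_fin ltW.
- exact/measurable_EFinP.
apply: filterS xy => w xyw _.
rewrite sumEFin -EFinM lee_fin (@garch_from_fixpoint _ _ mu x h n t)//.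
rewrite garch_from_lag_prod (eq_lag_prod n t xyw).
under [in leRHS]eq_bigr do rewrite (eq_lag_prod _ t xyw).
by rewrite lerDl mulr_ge0 ?lag_prod_ge0// ltW.
Qed.

Lemma integral_recurrence_pinfty t : 1 <= a -> (\int[P]_w (h t w)%:E = +oo)%E.
Proof.
move=> a1; apply: eq_infty => r.
(* Each power of [a] is at least 1, so more than [r / mu] terms bring the bound above [r]. *)
apply: le_trans (sum_lag_prod_le (Num.truncn (r / mu)).+1 t).
rewrite lee_fin mulrC -ler_pdivrMr//.
apply: (@le_trans _ _ (\sum_(0 <= i < (Num.truncn (r / mu)).+1) 1)).
  by rewrite sumr_const_nat subn0; apply: ltW; exact: truncnS_gt.
by apply: ler_sum => i _; exact: exprn_ege1.
Qed.

Lemma integral_recurrence (V : T -> R) t : a < 1 ->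
  {ae P, forall w, garch_from mu x V n t w @[n --> \oo] --> h t w} ->
  (\int[P]_w (h t w)%:E = (mu / (1 - a))%:E)%E.
Proof.
move=> a1 cvgV.
pose S w : \bar R := (\sum_(n <oo) (lag_prod y n t w)%:E)%E.
have S0 w : (0 <= S w)%E.
  by apply: nneseries_ge0 => n _ _; rewrite lee_fin lag_prod_ge0.
have mS : measurable_fun setT S.
  by apply: ge0_emeasurable_sum => // n w _ _; rewrite lee_fin lag_prod_ge0.
have ES : (\int[P]_w S w = ((1 - a)^-1)%:E)%E.
  rewrite integral_nneseries//; last by move=> n w _; rewrite lee_fin lag_prod_ge0.
  under eq_eseriesr do rewrite E_y.
  have := @cvg_geometric_series R 1 a; rewrite ger0_norm// mul1r => /(_ a1) cg.
  apply/cvg_lim => //.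
  rewrite (_ : (fun n => _) = EFin \o series (geometric 1 a)).
    by apply: cvg_EFin; [exact: nearW|exact: cg].
  apply/funext => n /=; rewrite sumEFin; congr EFin.
  by apply: eq_bigr => i _; rewrite /geometric/= mul1r.
(* A nonnegative series with finite mean is finite almost surely. *)
have Sfin : {ae P, forall w, S w \is a fin_num}.
  have iS : P.-integrable setT S.
    apply/integrableP; split => //.
    by under eq_integral do rewrite gee0_abs//; rewrite ES ltry.
  by have := integrable_ae measurableT iS; apply: filterS => w; apply.
transitivity (\int[P]_w (mu%:E * S w))%E; last first.
  by rewrite ge0_integralZl ?ES// lee_fin ltW.
apply: ge0_ae_eq_integral => //.
- exact/measurable_EFinP.
- exact: measurable_funeM.
- by move=> w _; rewrite lee_fin ltW.
- by move=> w _; rewrite mule_ge0// lee_fin ltW.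
apply: filterS3 cvgV Sfin xy => w cw Sw xyw _.
have lagS : series (fun n => lag_prod y n t w) @ \oo --> fine (S w).
  have cS : (\sum_(0 <= i < n) (lag_prod y i t w)%:E @[n --> \oo] -->
      (fine (S w))%:E)%E.
    rewrite fineK//; apply: is_cvg_nneseries => n _ _.
    by rewrite lee_fin lag_prod_ge0.
  have := fine_cvg cS.
  rewrite (_ : fine \o _ = series (fun n => lag_prod y n t w)); first by apply.
  by apply/funext => n /=; rewrite sumEFin.
(* For fixed [w], [V w] is a fixed real, so this alone removes the initial value in the limit. *)
have lag0 : lag_prod y n t w @[n --> \oo] --> 0.
  by apply: cvg_series_cvg_0; apply/cvg_ex; exists (fine (S w)).
have cS : garch_from mu x V n t w @[n --> \oo] --> mu * fine (S w).
  rewrite -[X in _ --> X]addr0 -[0 in X in _ --> X](mul0r (V w)).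
  rewrite (_ : (fun n => _) = (fun n => mu * series (fun n => lag_prod y n t w) n
     + lag_prod y n t w * V w)); last first.
    apply/funext => n; rewrite garch_from_lag_prod (eq_lag_prod n t xyw).
    by congr (_ * _ + _); apply: eq_bigr => i _; rewrite (eq_lag_prod i t xyw).
  apply: cvgD; apply: cvgM => //; exact: cvg_cst.
by rewrite -[S w in RHS]fineK// -EFinM; congr EFin; apply: cvg_unique cw cS.
Qed.

End random_recurrence.

(** * Finiteness criterion, mean of [h t] and Aumann mean of the interval *)

Theorem theorem1 (R : realType) (d : measure_display) (T : measurableType d)
  (P : probability T R) (mu alpha1 beta1 gamma1 k : R)
  (eps eta h : int -> T -> R) :
  0 < mu -> 0 < alpha1 -> 0 < beta1 -> 0 < gamma1 -> 0 < k ->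
  (forall t, measurable_fun setT (eps t)) ->
  (forall t, measurable_fun setT (eta t)) ->
  (forall t, measurable_fun setT (h t)) ->
  (* eps_t ~ N(0,1), eta_t ~ Gamma(k,1) *)
  (forall t (A : set R), measurable A -> P (eps t @^-1` A) = normal_prob 0 1 A) ->
  (forall t (A : set R), measurable A -> P (eta t @^-1` A) = gamma_prob k A) ->
  (* {eps_t}, {eta_t} i.i.d. and mutually independent *)
  mutually_independent P
    (fun i : int + int => match i with inl t => eps t | inr t => eta t end) ->
  (* (eps_t, eta_t) independent of {h_s : s <= t} *)
  (forall t, independent_families P
     (fun b : bool => if b then eps t else eta t) setT h [set s | s <= t]) ->
  (forall t w, 0 < h t w) ->
  (forall t w, h t w = mu + alpha1 * `|lam h eps (t - 1) w|
                       + beta1 * del h eta (t - 1) w + gamma1 * h (t - 1) w) ->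
  started_in_infinite_past P mu (xproc alpha1 beta1 gamma1 eps eta) h ->
  forall t : int,
    (('E_P[h t] < +oo)%E <-> ('E_P[xproc alpha1 beta1 gamma1 eps eta t] < 1)%E) /\
    (('E_P[xproc alpha1 beta1 gamma1 eps eta t] < 1)%E <->
       alpha1 * Num.sqrt (2 / pi) + beta1 * k + gamma1 < 1) /\
    (alpha1 * Num.sqrt (2 / pi) + beta1 * k + gamma1 < 1 ->
       ('E_P[h t] = (mu / (1 - alpha1 * Num.sqrt (2 / pi) - beta1 * k - gamma1))%:E)%E /\
       interval_expectation P (lam h eps t) (del h eta t) =
         ((- k%:E * 'E_P[h t])%E, (k%:E * 'E_P[h t])%E)).
Proof.
move=> mu0 alpha0 beta0 gamma0 k0 meps meta mh law_eps law_eta indep indep_h h0 hE.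
move=> [V [mV [iV cvgV]]] t.
pose x := xproc alpha1 beta1 gamma1 eps eta.
pose y := xproc alpha1 beta1 gamma1 eps (fun t w => `|eta t w|).
pose a := alpha1 * Num.sqrt (2 / pi) + beta1 * k + gamma1.
have E_eps s : (\int[P]_w `|eps s w|%:E = (Num.sqrt (2 / pi))%:E)%E.
  exact: (expectation_std_normal_abs (meps _) (law_eps _)).
have E_eta s : (\int[P]_w `|eta s w|%:E = k%:E)%E.
  exact: (expectation_gamma_abs k0 (meta _) (law_eta _)).
have E_y n s : (\int[P]_w (lag_prod y n s w)%:E = (a ^+ n)%:E)%E.
  by apply: integral_lag_prod => //; exact: ltW.
have my s : measurable_fun setT (y s).
  apply: measurable_funD => //; apply: measurable_funD; apply: measurable_funM => //.
    exact: measurableT_comp.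
  exact: measurableT_comp.
have mx s : measurable_fun setT (x s).
  apply: measurable_funD => //; apply: measurable_funD; apply: measurable_funM => //.
  exact: measurableT_comp.
have y0 s w : 0 <= y s w by rewrite /y /xproc !addr_ge0 ?mulr_ge0// ltW.
(* One null set must serve all integer times; countability is used on [Posz] and [Negz]
   separately. *)
have eta_ge0 : {ae P, forall w, forall s, 0 <= eta s w}.
  have pos : {ae P, forall w, forall n : nat, 0 <= eta (Posz n) w}.
    by apply: ae_foralln => n; exact: (gamma_ge0_ae (meta _) (law_eta _)).
  have neg : {ae P, forall w, forall n : nat, 0 <= eta (Negz n) w}.
    by apply: ae_foralln => n; exact: (gamma_ge0_ae (meta _) (law_eta _)).
  by apply: filterS2 pos neg => w p n [].
have xy : {ae P, forall w, forall s, x s w = y s w}.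
  apply: filterS eta_ge0 => w e0 s.
  by rewrite /x /y /xproc (ger0_norm (e0 s)).
have hxE s w : h s w = mu + x (s - 1) w * h (s - 1) w.
  rewrite hE /lam /del /x /xproc normrM (gtr0_norm (h0 _ _)); ring.
have E_x : ('E_P[x t] = a%:E)%E.
  (* [x t] agrees almost surely with the one-factor lagged product at time [t + 1]. *)
  rewrite unlock -(expr1 a) -(E_y 1%N (t + 1)).
  apply: ae_eq_integral => //.
  - exact/measurable_EFinP.
  - by apply/measurable_EFinP; exact: measurable_lag_prod.
  - by apply: filterS xy => w xyw _; rewrite /= addrK mulr1 xyw.
have h_lt1 : a < 1 -> ('E_P[h t] = (mu / (1 - a))%:E)%E.
  move=> a1; rewrite unlock.
  exact: (integral_recurrence mu0 my mh y0 h0 xy E_y a1 (cvgV t)).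
have h_ge1 : 1 <= a -> ('E_P[h t] = +oo)%E.
  move=> a1; rewrite unlock.
  exact: (integral_recurrence_pinfty mu0 my mh y0 h0 xy hxE E_y).
rewrite -/a -/x E_x lte_fin; split; [|split=> // a1].
  split; last by move=> /h_lt1 ->; rewrite ltry.
  by case: (ltP a 1) => // /h_ge1 ->.
rewrite h_lt1//; split; first by congr (_ / _)%:E; rewrite /a; ring.
set H := mu / (1 - a).
(* [indep_integralM] wants functions nonnegative on the whole line; [Num.norm] is one and does not
   change the positive [h t]. *)
have E_h : (\int[P]_w `|h t w|%:E = H%:E)%E.
  rewrite -h_lt1// unlock; apply: eq_integral => w _.
  by rewrite gtr0_norm.
have indep_eps A B : measurable A -> measurable B ->
    (P (eps t @^-1` A `&` h t @^-1` B) = P (eps t @^-1` A) * P (h t @^-1` B))%E.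
  move=> mA mB.
  have := indep_h t [:: true] [:: t] (fun=> A) (fun=> B).
  rewrite !set_cons1 !bigcap_set1; apply => //.
  by move=> s /= ->.
have indep_eta A B : measurable A -> measurable B ->
    (P (eta t @^-1` A `&` h t @^-1` B) = P (eta t @^-1` A) * P (h t @^-1` B))%E.
  move=> mA mB.
  have := indep_h t [:: false] [:: t] (fun=> A) (fun=> B).
  rewrite !set_cons1 !bigcap_set1; apply => //.
  by move=> s /= ->.
have E_lam : ('E_P[lam h eps t] = 0)%E.
  (* As [h t] is positive, the positive and negative parts of [lam] are those of [eps t] times
     [h t]. Both have mean [normal_peak 1 * H], which is finite, so the difference is 0. *)
  rewrite unlock integralE.
  have -> : (\int[P]_w ((fun w => (lam h eps t w)%:E)^\+ w) =
      \int[P]_w (Num.max (eps t w) 0 * `|h t w|)%:E)%E.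
    apply: eq_integral => w _; rewrite funeposE /lam -EFin_max; congr EFin.
    by rewrite gtr0_norm// maxr_pMl ?(ltW (h0 _ _))// mul0r mulrC.
  have -> : (\int[P]_w ((fun w => (lam h eps t w)%:E)^\- w) =
      \int[P]_w (Num.max (- eps t w) 0 * `|h t w|)%:E)%E.
    apply: eq_integral => w _; rewrite funenegE /lam -EFinN -EFin_max; congr EFin.
    by rewrite gtr0_norm// maxr_pMl ?(ltW (h0 _ _))// mul0r mulNr mulrC.
  rewrite (@indep_integralM _ _ _ P _ _ _ _ (eps t) (h t)
    (fun x => Num.max x 0) Num.norm (normal_peak 1))//; last 3 first.
  - exact: measurable_maxr.
  - by move=> u; rewrite le_max lexx orbT.
  - exact: (expectation_std_normal_pos (meps t) (law_eps t)).
  rewrite (@indep_integralM _ _ _ P _ _ _ _ (eps t) (h t)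
    (fun x => Num.max (- x) 0) Num.norm (normal_peak 1))//; last 3 first.
  - by apply: measurable_maxr => //; exact: measurableT_comp.
  - by move=> u; rewrite le_max lexx orbT.
  - exact: (expectation_std_normal_neg (meps t) (law_eps t)).
  by rewrite E_h subee.
have E_del : ('E_P[del h eta t] = (k * H)%:E)%E.
  rewrite EFinM -E_h -(@indep_integralM _ _ _ P _ _ _ _ (eta t) (h t)
    Num.norm Num.norm k)//.
  rewrite unlock; apply: ae_eq_integral => //.
  - by apply/measurable_EFinP/measurable_funM.
  - by apply/measurable_EFinP/measurable_funM; exact: measurableT_comp.
  - apply: filterS eta_ge0 => w e0 _.
    by rewrite /del ger0_norm// gtr0_norm// mulrC.
by rewrite /interval_expectation E_lam E_del sub0e add0e EFinM mulNe.
Qed.
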